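(* Let $(X,d)$ be a compact metric space, let $f_1,f_2:X\to X$ be continuous maps, and let $F=\{f_1,f_2\}$ be the associated multiple mappings. Suppose there is a point $c\in X$ such that $f_1(x)=c$ for all $x\in X$ and $f_2(c)=c$. If $f_2$ is Devaney chaotic, then $F$ is Devaney chaotic.
   Context: Single maps. Let $f:X\to X$ be continuous. A point $x$ is a periodic point of $f$ if $f^n(x)=x$ for some integer $n\ge 1$; $P(f)$ is the set of periodic points. $f$ is transitive if for any nonempty open $U,V\subset X$ there is an integer $n\ge1$ with $f^n(U)\cap V\ne\emptyset$. $f$ is sensitive if there exists $\delta>0$ such that for any nonempty open $U\subset X$ there exist $x,y\in U$ and an integer $n\ge 1$ with $d(f^n(x),f^n(y))>\delta$. $f$ is Devaney chaotic if $f$ is transitive, $\overline{P(f)}=X$, and $f$ is sensitive. Multiple mappings. For $F=\{f_1,f_2\}$, an integer $n>0$ and $x\in X$, put $$F^n(x)=\{f_{i_1}f_{i_2}\cdots f_{i_n}(x)\mid i_1,\dots,i_n\in\{1,2\}\}\subset X,$$ where juxtaposition denotes composition; in particular $F(x)=F^1(x)=\{f_1(x),f_2(x)\}$. The deleted orbit of $x$ under $F$ is the set of subsets $\mathring{orb}(x,F)=\{F(x),F^2(x),F^3(x),\dots\}$. A point $x\in X$ is a periodic point of $F$ if $\mathring{orb}(x,F)$ is finite (as a set of subsets of $X$) and there exists an integer $m>0$ such that $x\in F^m(x)$. $P(F)$ denotes the set of all periodic points of $F$. Let $\mathbb{K}(X)$ be the set of nonempty compact subsets of $X$, with the Hausdorff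 metric $$d_H(A,B)=\max\Big\{\sup_{a\in A}\inf_{b\in B}d(a,b),\ \sup_{b\in B}\inf_{a\in A}d(a,b)\Big\},$$ and let $Ran(F)=\{F^n(x)\mid n\ge 1,\ x\in X\}\subset\mathbb{K}(X)$, with the subspace topology induced by $d_H$. $F$ is (topologically) transitive if for any nonempty open set $U\subset X$ and any nonempty open set $\mathcal{U}\subset Ran(F)$ (open in $Ran(F)$), there exists an integer $n\ge 1$ such that $\{F^n(u)\mid u\in U\}\cap\mathcal{U}\neq\emptyset$. $F$ is (Hausdorff metric) sensitive if there exists $\delta>0$ such that for any nonempty open set $U\subset X$ there exist $x,y\in U$ and an integer $n\ge 1$ such that $d_H(F^n(x),F^n(y))>\delta$. $F$ is Devaney chaotic if $F$ is transitive, $\overline{P(F)}=X$, and $F$ is sensitive. *)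

(* Defs.v *)
From HB Require Import structures.
From mathcomp Require Import all_boot all_order all_algebra.
From mathcomp Require Import all_classical all_reals all_analysis.

Set Implicit Arguments.
Unset Strict Implicit.
Unset Printing Implicit Defensive.

Import Order.TTheory GRing.Theory Num.Theory.
Import numFieldNormedType.Exports.

Local Open Scope classical_set_scope.
Local Open Scope ring_scope.

Section SingleMap.
Context {R : realType} {X : metricType R}.
Implicit Types f : X -> X.

Definition periodic_points f : set X :=
  [set x | exists2 n : nat, (0 < n)%N & iter n f x = x].

Definition transitive_map f : Prop :=
  forall U V : set X, open U -> U !=set0 -> open V -> V !=set0 ->
  exists2 n : nat, (0 < n)%N & (iter n f @` U) `&` V !=set0.

Definition sensitive_map f : Prop :=
  exists2 delta : R, 0 < delta &
  forall U : set X, open U -> U !=set0 ->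
  exists x y (n : nat),
    [/\ U x, U y, (0 < n)%N & delta < mdist (iter n f x) (iter n f y)].

Definition devaney_map f : Prop :=
  [/\ transitive_map f, closure (periodic_points f) = setT & sensitive_map f].

End SingleMap.

Section HausdorffMetric.
Context {R : realType} {X : metricType R}.
Implicit Types A B C : set X.

Definition hausdorff_dist A B : R :=
  Num.max (sup [set inf [set mdist a b | b in B] | a in A])
          (sup [set inf [set mdist a b | a in A] | b in B]).

Let pdist x B : R := inf [set mdist x b | b in B].
Let excess A B : R := sup [set pdist a B | a in A].

Let hausdorff_distE A B :
  hausdorff_dist A B = Num.max (excess A B) (excess B A).
Proof.
rewrite /hausdorff_dist /excess; congr (Num.max _ (sup _)).
apply: eq_imagel => b _; congr inf; apply: eq_imagel => a _.
exact: metric_sym.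
Qed.

Let pdist_le x B b : B b -> pdist x B <= mdist x b.
Proof.
move=> Bb; apply: ge_inf; last by exists b.
by exists 0 => _ [c _ <-]; exact: mdist_ge0.
Qed.

Let pdist_ge0 x B : B !=set0 -> 0 <= pdist x B.
Proof.
move=> [b Bb]; apply: lb_le_inf; first by exists (mdist x b), b.
by move=> _ [c _ <-]; exact: mdist_ge0.
Qed.

Let pdist_lt x B r : B !=set0 -> pdist x B < r -> exists2 b, B b & mdist x b < r.
Proof.
move=> [b Bb] /inf_lt => /(_ (ex_intro _ _ (ex_intro2 _ _ b Bb erefl))).
by move=> [_ [c Bc <-]]; exists c.
Qed.

Let mdist_lip (x y b : X) : `|mdist x b - mdist y b : R| <= mdist x y.
Proof.
rewrite ler_norml lerBrDr lerBlDr metric_triangle andbT addrC lerBlDr addrC.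
by rewrite [X in X + _]metric_sym metric_triangle.
Qed.

Let mdist_continuous (b : X) : continuous (fun x : X => mdist x b : R^o).
Proof.
move=> x; apply/cvgrPdist_lt => e e0.
apply/nbhs_ballP; exists e => // y; rewrite ballEmdist /= => xye.
exact: le_lt_trans (mdist_lip x y b) xye.
Qed.

Let excess_ub A B : compact A -> B !=set0 ->
  has_ubound [set pdist a B | a in A].
Proof.
move=> cA [b Bb].
have [->|/set0P [a Aa]] := eqVneq A set0; first by rewrite image_set0; exists 0.
have /compact_has_sup [|_ [M hM]] :
    compact ((fun x : X => mdist x b : R^o) @` A).
- apply: continuous_compact => //; apply: continuous_subspaceT.
  exact: mdist_continuous.
- by exists (mdist a b), a.
exists M => _ [x Ax <-]; apply: le_trans (pdist_le x Bb) _.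
by apply: hM; exists x.
Qed.

Let excess_ge A B a : compact A -> B !=set0 -> A a -> pdist a B <= excess A B.
Proof. by move=> cA B0 Aa; apply: ub_le_sup; [exact: excess_ub|exists a]. Qed.

Let excess_le A B r : A !=set0 -> (forall a, A a -> pdist a B <= r) ->
  excess A B <= r.
Proof.
move=> [a Aa] h; apply: ge_sup; first by exists (pdist a B), a.
by move=> _ [x Ax <-]; exact: h.
Qed.

Let excess_triangle A B C : A !=set0 -> compact A -> B !=set0 -> compact B ->
  C !=set0 -> excess A C <= excess A B + excess B C.
Proof.
move=> A0 cA B0 cB C0; apply: excess_le => // a Aa.
apply/ler_addgt0Pr => e e0; have e20 : 0 < e / 2 by rewrite divr_gt0.
have [b Bb ab] : exists2 b, B b & mdist a b < excess A B + e / 2.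
  by apply: pdist_lt => //; rewrite ltr_pwDr ?excess_ge.
have [c Cc bc] : exists2 c, C c & mdist b c < excess B C + e / 2.
  by apply: pdist_lt => //; rewrite ltr_pwDr ?excess_ge.
rewrite (le_trans (pdist_le a Cc))// (le_trans (metric_triangle a b c))//.
by rewrite [e]splitr addrACA lerD// ltW.
Qed.

Let excess_xx A : A !=set0 -> compact A -> excess A A = 0.
Proof.
move=> A0 cA; apply/eqP; rewrite eq_le; apply/andP; split.
  by apply: excess_le => // a Aa; rewrite -(mdistxx a) pdist_le.
by have [a Aa] := A0; rewrite (le_trans (pdist_ge0 a A0))// excess_ge.
Qed.

Let excess_sub A B : compact A -> B !=set0 -> compact B ->
  excess A B <= 0 -> A `<=` B.
Proof.
move=> cA B0 cB AB0 a Aa.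
have clB : closed B by apply: compact_closed => //; exact: metric_hausdorff.
apply: clB => U /nbhs_ballP[e /= e0 aeU].
have [b Bb abe] : exists2 b, B b & mdist a b < e.
  apply: pdist_lt => //; apply: le_lt_trans e0.
  exact: le_trans (excess_ge _ _ Aa) AB0.
by exists b; split => //; apply: aeU; rewrite ballEmdist.
Qed.

Lemma hausdorff_distxx A : A !=set0 -> compact A -> hausdorff_dist A A = 0.
Proof. by move=> *; rewrite hausdorff_distE maxxx excess_xx. Qed.

Lemma hausdorff_dist_sym A B : hausdorff_dist A B = hausdorff_dist B A.
Proof. by rewrite !hausdorff_distE maxC. Qed.

Lemma hausdorff_dist_eq0 A B : A !=set0 -> compact A -> B !=set0 -> compact B ->
  hausdorff_dist A B = 0 -> A = B.
Proof.
rewrite hausdorff_distE => A0 cA B0 cB AB.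
have /andP[AB0 BA0] : (excess A B <= 0) && (excess B A <= 0).
  by rewrite -ge_max AB.
by apply/seteqP; split; exact: excess_sub.
Qed.

Lemma hausdorff_dist_triangle B A C : A !=set0 -> compact A ->
  B !=set0 -> compact B -> C !=set0 -> compact C ->
  hausdorff_dist A C <= hausdorff_dist A B + hausdorff_dist B C.
Proof.
move=> A0 cA B0 cB C0 cC; rewrite !hausdorff_distE ge_max.
apply/andP; split; apply: le_trans (excess_triangle _ _ B0 _ _) _ => //.
  by rewrite lerD// le_max lexx.
by rewrite addrC lerD// le_max lexx orbT.
Qed.

End HausdorffMetric.

(* The hyperspace K(X). *)
Record hyperspace (X : topologicalType) := Hyperspace {
  hyperspace_set :> set X ;
  hyperspace_neq0 : hyperspace_set !=set0 ;
  hyperspace_compact : compact hyperspace_set }.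

Lemma hyperspace_inj (X : topologicalType) (A B : hyperspace X) :
  A = B :> set X -> A = B.
Proof.
case: A B => [A A0 cA] [B B0 cB] /= AB; rewrite AB in A0 cA *.
by congr Hyperspace; exact: Prop_irrelevance.
Qed.

HB.instance Definition _ (X : topologicalType) := gen_eqMixin (hyperspace X).
HB.instance Definition _ (X : topologicalType) :=
  gen_choiceMixin (hyperspace X).

Section HyperspaceMetric.
Context {R : realType} {X : metricType R}.
Implicit Types A B C : hyperspace X.

Let dist A B : R := hausdorff_dist A B.

Let distxx A : dist A A = 0.
Proof. by case: A => A *; exact: hausdorff_distxx. Qed.

Let dist_positivity A B : dist A B = 0 -> A = B.
Proof.
case: A B => [A A0 cA] [B B0 cB] AB.
by apply: hyperspace_inj; exact: hausdorff_dist_eq0 AB.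
Qed.

Let dist_sym A B : dist A B = dist B A.
Proof. exact: hausdorff_dist_sym. Qed.

Let dist_triangle B A C : dist A C <= dist A B + dist B C.
Proof.
case: A B C => [A A0 cA] [B B0 cB] [C C0 cC].
exact: hausdorff_dist_triangle.
Qed.

HB.instance Definition _ := @isMetric.Build R (hyperspace X)
  dist distxx dist_positivity dist_sym dist_triangle.

Lemma hyperspace_mdistE A B : mdist A B = hausdorff_dist A B :> R.
Proof. by []. Qed.

End HyperspaceMetric.

(* A pair {f_1, f_2} is encoded as a family indexed by bool, with f_1 at true. *)
Definition multimap {X : Type} (f1 f2 : X -> X) : bool -> X -> X :=
  fun i => if i then f1 else f2.

Section MultipleMappings.
Context {R : realType} {X : metricType R}.
Implicit Types (F : bool -> X -> X) (x : X) (n : nat).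

(* The word i = (i_1, ..., i_n) acts as the composite f_(i_1) ... f_(i_n), so
   its last letter is applied first. *)
Definition mm_iter_set F n x : set X :=
  [set foldr F x i | i in [set: n.-tuple bool]].

Lemma mm_iter_set_neq0 F n x : mm_iter_set F n x !=set0.
Proof. by exists (foldr F x [tuple of nseq n true]), [tuple of nseq n true]. Qed.

Lemma mm_iter_set_compact F n x : compact (mm_iter_set F n x).
Proof. by apply: finite_compact; apply: finite_image; exact: finite_finset. Qed.

Definition mm_iter F n x : hyperspace X :=
  Hyperspace (mm_iter_set_neq0 F n x) (mm_iter_set_compact (F:=F) (n:=n) (x:=x)).

Definition mm_deleted_orbit F x : set (set X) :=
  [set mm_iter_set F n x | n in [set n | (0 < n)%N]].

Definition mm_periodic_points F : set X :=
  [set x | finite_set (mm_deleted_orbit F x) /\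
           exists2 m : nat, (0 < m)%N & mm_iter_set F m x x].

Definition mm_ran F : set (hyperspace X) :=
  [set A | exists n x, (0 < n)%N /\ A = mm_iter F n x].

Definition mm_ran_open F (UU : set (hyperspace X)) : Prop :=
  exists2 W : set (hyperspace X), open W & UU = W `&` mm_ran F.

Definition mm_transitive F : Prop :=
  forall (U : set X) (UU : set (hyperspace X)),
  open U -> U !=set0 -> mm_ran_open F UU -> UU !=set0 ->
  exists2 n : nat, (0 < n)%N & [set mm_iter F n u | u in U] `&` UU !=set0.

Definition mm_sensitive F : Prop :=
  exists2 delta : R, 0 < delta &
  forall U : set X, open U -> U !=set0 ->
  exists x y (n : nat),
    [/\ U x, U y, (0 < n)%N & delta < mdist (mm_iter F n x) (mm_iter F n y)].

Definition mm_devaney F : Prop :=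
  [/\ mm_transitive F, closure (mm_periodic_points F) = setT & mm_sensitive F].

End MultipleMappings.

(* Main.v *)
(** Every word of length [n > 0] other than [f2^n] contains the constant map
    [f1], so it takes the value [f2^k c = c]; hence [F^n(x) = {c, f2^n(x)}].
    The Hausdorff distance between [{c, y}] and [{c, z}] lies between
    [d(y, z) / 2] and [d(y, z)], which transfers sensitivity and transitivity
    from [f2] to [F]. *)
Require Import Defs.
From mathcomp Require Import all_boot all_order all_algebra.
From mathcomp Require Import all_classical all_reals all_analysis.
From mathcomp Require Import lra.

Import Order.TTheory GRing.Theory Num.Theory.

Local Open Scope classical_set_scope.
Local Open Scope ring_scope.

Lemma sup_set2 (R : realType) (a b : R) : sup [set a; b] = Num.max a b.
Proof.
wlog ab : a b / a <= b.
  by move=> h; have /orP[/h//|/h] := le_total a b; rewrite setUC maxC.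
by rewrite sup_setU ?sup1 ?(max_idPr ab)//; move=> _ _ -> ->.
Qed.

Lemma inf_set2 (R : realType) (a b : R) : inf [set a; b] = Num.min a b.
Proof.
wlog ab : a b / a <= b.
  by move=> h; have /orP[/h//|/h] := le_total a b; rewrite setUC minC.
by rewrite inf_setU ?inf1 ?(min_idPl ab)//; move=> _ _ -> ->.
Qed.

Section PairsWithCommonPoint.
Context {R : realType} {X : metricType R}.
Implicit Types c y z : X.

(** The shared point [c] is at distance 0 from the other set, so each one-sided supremum is attained
    at [y], respectively [z]. *)
Lemma hausdorff_dist_set2 c y z : hausdorff_dist [set c; y] [set c; z] =
  Num.max (Num.min (mdist y c) (mdist y z))
          (Num.min (mdist c z) (mdist y z)) :> R.
Proof.
rewrite /hausdorff_dist !image_setU !image_set1 !image_setU !image_set1.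
rewrite !inf_set2 !sup_set2 !mdistxx.
rewrite !(min_idPl (mdist_ge0 _ _)).
by congr Num.max; apply: max_r; rewrite le_min !mdist_ge0.
Qed.

Lemma hausdorff_dist_set2_le c y z :
  hausdorff_dist [set c; y] [set c; z] <= mdist y z :> R.
Proof. by rewrite hausdorff_dist_set2 ge_max !ge_min !lexx !orbT. Qed.

(** If [y] is at least [mdist y z / 2] away from [c], the first minimum is large enough; otherwise
    the triangle inequality puts [z] that far from [c], and the second one is. *)
Lemma hausdorff_dist_set2_ge c y z :
  mdist y z / 2 <= hausdorff_dist [set c; y] [set c; z] :> R.
Proof.
rewrite hausdorff_dist_set2 le_max !le_min.
have := metric_triangle y c z; have := mdist_ge0 y z.
have [|yc yz0 tri] := leP (mdist y z / 2) (mdist y c).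
  by move=> _ yz0 _; apply/orP; left; lra.
by apply/orP; right; apply/andP; split; lra.
Qed.

End PairsWithCommonPoint.

Lemma iter_modn (T : Type) (f : T -> T) (p n : nat) (x : T) :
  iter p f x = x -> iter (n %% p) f x = iter n f x.
Proof.
move=> fx; rewrite {2}(divn_eq n p) addnC iterD; congr iter.
by elim: (n %/ p)%N => // k IH; rewrite mulSn iterD -IH.
Qed.

Section ConstantFirstMap.
Context {R : realType} {X : metricType R}.
Variables (f1 f2 : X -> X) (c : X).
Hypotheses (f1_const : forall x, f1 x = c) (f2_fix : f2 c = c).
Let F := multimap f1 f2.

(** Induction on the outermost letter: [f1] resets any value to [c], while [f2] fixes [c] or adds
    one iteration. *)
Lemma mm_word_value (s : seq bool) x :
  foldr F x s = if true \in s then c else iter (size s) f2 x.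
Proof.
elim: s => [//|[] s IH] /=; first by rewrite /F /= f1_const.
by rewrite in_cons /= IH; case: ifP.
Qed.

Lemma mm_iter_setE n x : (0 < n)%N ->
  mm_iter_set F n x = [set c; iter n f2 x].
Proof.
move=> n0; apply/seteqP; split=> [_ [s _ <-]|_ [->|->]].
- by rewrite mm_word_value size_tuple; case: ifP => _; [left|right].
(* Positivity of [n] matters here: the empty word has no letter [true] and never yields [c] by a
   reset. *)
- by exists [tuple of nseq n true] => //; rewrite mm_word_value mem_nseq n0.
- exists [tuple of nseq n false] => //.
  by rewrite mm_word_value mem_nseq andbF size_nseq.
Qed.

Lemma mm_iter_mdistE m n x y : (0 < m)%N -> (0 < n)%N ->
  mdist (mm_iter F m x) (mm_iter F n y) =
  hausdorff_dist [set c; iter m f2 x] [set c; iter n f2 y] :> R.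
Proof. by move=> m0 n0; rewrite hyperspace_mdistE /= !mm_iter_setE. Qed.

Lemma periodic_points_mm : periodic_points f2 `<=` mm_periodic_points F.
Proof.
move=> x [p p0 fx]; split; last by exists p => //; rewrite mm_iter_setE//; right.
(* One set per residue modulo the period [p]. Residue 0 must stand for [[set c; x]], whereas
   [mm_iter_set F 0 x] is only the singleton of [x]. *)
apply: (@sub_finite_set _ _ ((fun k => [set c; iter k f2 x]) @` `I_p)).
  move=> _ [n n0 <-]; exists (n %% p)%N; first exact: ltn_pmod.
  by rewrite mm_iter_setE// iter_modn.
exact/finite_image/finite_II.
Qed.

Lemma transitive_map_mm : transitive_map f2 -> mm_transitive F.
Proof.
move=> f2T U _ oU U0 [W oW ->] [A [WA [n [x [n0 eA]]]]].
rewrite {}eA {A} in WA.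
have /nbhs_ballP[e /= e0 eW] : nbhs (mm_iter F n x) W by exact: open_nbhs_nbhs.
(* Steering [iter m f2 u] close to [iter n f2 x] suffices even when [m] and [n] differ, because both
   image sets contain [c]. *)
have [|m m0 [_ [[u Uu <-] Vu]]] :=
    f2T U (ball (iter n f2 x) e)° oU U0 (open_interior _).
  by exists (iter n f2 x); exact: nbhsx_ballx.
exists m => //; exists (mm_iter F m u); split; first by exists u.
split; last by exists m, u.
apply: eW; rewrite ballEmdist /= mm_iter_mdistE//.
apply: le_lt_trans (hausdorff_dist_set2_le _ _ _) _.
by have := interior_subset Vu; rewrite ballEmdist.
Qed.

Lemma sensitive_map_mm : sensitive_map f2 -> mm_sensitive F.
Proof.
(* Halving [d] absorbs the factor lost in [hausdorff_dist_set2_ge]. *)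
move=> [d d0 f2S]; exists (d / 2); first by rewrite divr_gt0.
move=> U oU /(f2S U oU)[x [y [n [Ux Uy n0 dxy]]]]; exists x, y, n; split => //.
rewrite mm_iter_mdistE//; apply: lt_le_trans (hausdorff_dist_set2_ge _ _ _).
by rewrite ltr_pM2r.
Qed.

End ConstantFirstMap.

Theorem corollary4p2 (R : realType) (X : metricType R)
    (X_compact : compact [set: X])
    (f1 f2 : X -> X) (f1_cont : continuous f1) (f2_cont : continuous f2)
    (c : X) (f1_const : forall x : X, f1 x = c) (f2_fix : f2 c = c) :
  devaney_map f2 -> mm_devaney (multimap f1 f2).
Proof.
move=> [f2T f2P f2S]; split.
- exact: transitive_map_mm f1_const f2_fix f2T.
- apply/seteqP; split=> // x _.
  apply: (closureS (periodic_points_mm _ _ _ f1_const f2_fix)).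
  by rewrite f2P.
- exact: sensitive_map_mm f1_const f2_fix f2S.
Qed.
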